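(* Let $T$ be a tree of order $n\ge 1$. Then $d(T)\le f(n)$, where $$f(n)=\begin{cases}2^{n-1}+(n+3)\cdot 2^{\frac{n-5}{2}}, & n \text{ odd},\\ 2^{n-1}+(n+6)\cdot 2^{\frac{n-6}{2}}, & n\text{ even}.\end{cases}$$ Equality holds if and only if $T\cong F_n$, where: - $F_n=K_1\ast \tfrac{n-1}{2}K_2$ if $n$ is odd; - $F_n\in\{P_6,\ K_2\ast 2K_2\}$ if $n=6$; - $F_n=K_2\ast\tfrac{n-2}{2}K_2$ if $n$ is even and $n\ne 6$.
   Context: All graphs are finite, simple and undirected. A subset $D\subseteq V(G)$ is a dissociation set of $G$ if the induced subgraph $G[D]$ has maximum degree at most $1$; the empty set is a dissociation set. $d(G)$ denotes the total number of dissociation sets of $G$, including the empty set. Notation $K_r\ast H$: let $H$ be a graph all of whose components are complete graphs, and let $K_r$ be a complete graph disjoint from $H$. Then $K_r\ast H$ is the connected graph obtained by choosing one vertex $u$ of $K_r$ and joining $u$ by an edge to exactly one vertex of each component of $H$. Here $mK_2$ denotes $m$ disjoint edges. Thus: - $K_1\ast mK_2$ is a vertex adjacent to one endpoint of each of $m$ disjoint edges; - $K_2\ast mK_2$ is an edge $uw$ with $u$ adjacent to one endpoint of each of $m$ disjoint edges. $P_6$ is the path on $6$ vertices. *)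

(* Defs.v *)
From mathcomp Require Import all_boot all_order all_algebra.
Set Implicit Arguments. Unset Strict Implicit. Unset Printing Implicit Defensive.
Import Order.TTheory GRing.Theory Num.Theory.

(* A simple graph on a finite type T is a symmetric irreflexive relation e. *)

Definition connected_graph (T : finType) (e : rel T) : Prop :=
  forall x y : T, connect e x y.

Definition acyclic_graph (T : finType) (e : rel T) : Prop :=
  forall c : seq T, ucycle e c -> (size c < 3)%N.

Definition is_tree (T : finType) (e : rel T) : Prop :=
  connected_graph e /\ acyclic_graph e.

Definition dissociation (T : finType) (e : rel T) (D : {set T}) : bool :=
  [forall x in D, #|[set y in D | e x y]| <= 1]%N.

Definition dnum (T : finType) (e : rel T) : nat :=
  #|[set D : {set T} | dissociation e D]|.

Definition iso_to (T : finType) (e : rel T) (R : rel 'I_#|T|) : Prop :=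
  exists g : T -> 'I_#|T|, bijective g /\ forall x y, e x y = R (g x) (g y).

Definition symc (b : nat -> nat -> bool) (n : nat) : rel 'I_n :=
  fun i j => b (val i) (val j) || b (val j) (val i).

Arguments symc b n : clear implicits.

(* K_1 * mK_2 on vertices 0..2m: centre 0, pendant edges {2i-1,2i},
   0 adjacent to 2i-1. *)
Definition b_odd (x y : nat) : bool :=
  ((x == 0) && odd y) || (odd x && (y == x.+1)).

(* K_2 * mK_2 on vertices 0..2m+1: edge {0,1}, pendant edges {2i,2i+1}
   (i >= 1), 0 adjacent to 2i. *)
Definition b_even (x y : nat) : bool :=
  [|| (x == 0) && (y == 1),
      [&& x == 0, ~~ odd y & (2 <= y)%N]
    | [&& ~~ odd x, (2 <= x)%N & y == x.+1]].

Definition b_path (x y : nat) : bool := y == x.+1.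

Local Open Scope ring_scope.

Definition fbound (n : nat) : rat :=
  if odd n then
    2 ^+ (n.-1) + (n + 3)%:R * (2 : rat) ^ ((n./2)%:Z - 2)
  else
    2 ^+ (n.-1) + (n + 6)%:R * (2 : rat) ^ ((n./2)%:Z - 3).

(* Main.v *)
(* Build a rooted tree by repeatedly hanging one rooted tree from the root of
   another, and count the dissociation sets avoiding the root, containing it
   isolated, and containing it matched.  Two leaves at a common vertex of degree
   at least 3 are never optimal: moving one onto the other gains dissociation
   sets.  Without such twins, either the tree is a root carrying paths of
   length 2 and at most one leaf (the extremal trees), or, looking at a deepest branching
   vertex, an edge splits off such a spider from the remaining tree [q].  In the
   latter case the bound for [q] gives the strict bound for the whole tree,
   except when the spider is a path on 3 vertices rooted at an end and [q] has at
   most 5 vertices; these cases are enumerated and produce only the path P_6. *)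

Require Import Defs.
From mathcomp Require Import all_boot all_order all_algebra.
From mathcomp Require Import zify ring.
Set Implicit Arguments. Unset Strict Implicit. Unset Printing Implicit Defensive.

(** * Rooted trees and their counts *)

(* In [Join r q] the root of [q] is attached to the root of [r], which remains
   the root; the vertices are the [Leaf] constructors. *)
Inductive rtree := Leaf | Join of rtree & rtree.

Fixpoint nverts (t : rtree) : nat :=
  if t is Join r q then nverts r + nverts q else 1.

(* Dissociation sets avoiding the root, containing it with no neighbour, and
   containing it with one neighbour. *)
Fixpoint n_out (t : rtree) : nat :=
  if t is Join r q then n_out r * (n_out q + n_iso q + n_mat q) else 1
with n_iso (t : rtree) : nat :=
  if t is Join r q then n_iso r * n_out q else 1
with n_mat (t : rtree) : nat :=
  if t is Join r q then n_mat r * n_out q + n_iso r * n_iso q else 0.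

Definition n_diss t := n_out t + n_iso t + n_mat t.

Notation K2 := (Join Leaf Leaf).

(* The root carries [k] legs of length 2 and, if [s], one leaf: [spider false k] is
   K_1 * kK_2 and [spider true k] is K_2 * kK_2. *)
Definition spider (s : bool) (k : nat) : rtree :=
  iter k (Join^~ K2) (if s then K2 else Leaf).

(* Isomorphism of rooted trees; [eqv] below also allows moving the root. *)
Inductive eqr : rtree -> rtree -> Prop :=
| eqr_refl t : eqr t t
| eqr_trans t u v : eqr t u -> eqr u v -> eqr t v
| eqr_swap r p q : eqr (Join (Join r p) q) (Join (Join r q) p)
| eqr_joinl r r' q : eqr r r' -> eqr (Join r q) (Join r' q)
| eqr_joinr r q q' : eqr q q' -> eqr (Join r q) (Join r q').

Inductive eqv : rtree -> rtree -> Prop :=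
| eqv_eqr t u : eqr t u -> eqv t u
| eqv_reroot r q : eqv (Join r q) (Join q r)
| eqv_trans t u v : eqv t u -> eqv u v -> eqv t v.

Lemma nverts_gt0 t : 0 < nverts t.
Proof. by elim: t => //= r IHr q IHq; rewrite addn_gt0 IHr. Qed.

Lemma eqr_nverts t u : eqr t u -> nverts t = nverts u.
Proof. by elim=> //= *; lia. Qed.

Lemma eqr_counts t u : eqr t u ->
  [/\ n_out t = n_out u, n_iso t = n_iso u & n_mat t = n_mat u].
Proof.
elim=> {t u} //=.
- by move=> t u v _ [-> -> ->] _ [-> -> ->].
- by move=> r p q; split; nia.
- by move=> r r' q _ [-> -> ->].
- by move=> r q q' _ [-> -> ->].
Qed.

Lemma eqv_nverts t u : eqv t u -> nverts t = nverts u.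
Proof.
elim=> {t u} [t u /eqr_nverts //|r q|t u v _ -> _ ->] //=; exact: addnC.
Qed.

Lemma eqv_n_diss t u : eqv t u -> n_diss t = n_diss u.
Proof.
rewrite /n_diss.
elim=> {t u} [t u /eqr_counts[-> -> ->]|r q|t u v _ -> _ ->] //=; nia.
Qed.

Lemma n_out_gt0 t : 0 < n_out t.
Proof. by elim: t => //= r IHr q IHq; rewrite muln_gt0 IHr !addn_gt0 IHq. Qed.

Lemma n_iso_gt0 t : 0 < n_iso t.
Proof. by elim: t => //= r IHr q IHq; rewrite muln_gt0 IHr n_out_gt0. Qed.

Lemma n_mat_gt0 t : 1 < nverts t -> 0 < n_mat t.
Proof. by case: t => //= r q _; rewrite addn_gt0 !muln_gt0 !n_iso_gt0 orbT. Qed.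

(** Half of all vertex subsets avoid the root and half contain it; each class of dissociation sets
    lies in one half. *)
Lemma counts_le t :
  (n_out t).*2 <= 2 ^ nverts t /\ (n_iso t + n_mat t).*2 <= 2 ^ nverts t.
Proof.
elim: t => //= r [IHr1 IHr2] q [IHq1 IHq2]; rewrite expnD; split.
  by rewrite -!mul2n mulnA; apply: leq_mul; lia.
have le_sum : n_out q + n_iso q <= 2 ^ nverts q by lia.
apply: leq_trans (leq_mul IHr2 le_sum).
by rewrite -!mul2n -mulnA leq_mul2l /= !mulnDl !mulnDr; lia.
Qed.

Lemma n_diss_le t : n_diss t <= 2 ^ nverts t.
Proof. by have [] := counts_le t; rewrite /n_diss; lia. Qed.

(* Moves one of two twin leaves onto the other. *)
Lemma twin_lt r q :
  n_diss (Join (Join (Join r q) Leaf) Leaf) < n_diss (Join (Join r q) K2).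
Proof.
have := @n_mat_gt0 (Join r q) _; rewrite /= => /(_ _).
have h : 1 < nverts r + nverts q by have := nverts_gt0 r; have := nverts_gt0 q; lia.
move=> /(_ h); rewrite /n_diss /=; nia.
Qed.

Lemma nverts_spider s k : nverts (spider s k) = (s + k.*2).+1.
Proof. by elim: k => [|k /= ->]; case: s => //=; lia. Qed.

Lemma n_out_spider s k : n_out (spider s k) = 2 ^ s * (2 ^ k) ^ 2.
Proof.
elim: k => [|k /= ->]; first by case: s.
by rewrite (expnS 2 k) expnMn [RHS]mulnCA [RHS]mulnC.
Qed.

Lemma n_iso_spider s k : n_iso (spider s k) = 2 ^ k.
Proof. by elim: k => [|k /= ->]; [case: s | rewrite expnS; lia]. Qed.

(** The root is matched either to its leaf, in [2 ^ k] ways, or into one of the [k] legs, in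
    [2 ^ k.-1] ways each. Doubling avoids the exponent [k.-1]. *)
Lemma n_mat_spider s k : (n_mat (spider s k)).*2 = 2 ^ k * (s.*2 + k).
Proof.
elim: k => [|k /= IHk]; first by case: s.
rewrite n_iso_spider expnS; move: (n_mat _) (2 ^ k) IHk => m z; lia.
Qed.

(** * Decomposition of rooted trees *)

Definition twin t := exists r, eqv t (Join (Join r Leaf) Leaf).
(** The condition [0 < k] rules out [Leaf] and [K2], the branches that a spider itself carries. *)
Definition split_spider t :=
  exists s k q, 0 < k /\ eqv t (Join (spider s k) q).
Definition reducible t := twin t \/ split_spider t.
(** The quantification over [qs] makes reducibility survive hanging further trees from the root, so
    that it passes from [r] to [Join r q] in the induction. *)
Definition deep t := forall qs, reducible (foldl Join t qs).

Lemma reducible_eqv t u : eqv t u -> reducible u -> reducible t.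
Proof.
move=> tu [[r ur]|[s [k [q [k0 uq]]]]]; [left; exists r|right; exists s, k, q].
  exact: eqv_trans ur.
by split=> //; exact: eqv_trans uq.
Qed.

Lemma eqr_foldl t u qs : eqr t u -> eqr (foldl Join t qs) (foldl Join u qs).
Proof. by elim: qs t u => //= q qs IHqs t u tu; apply/IHqs/eqr_joinl. Qed.

Lemma eqr_foldl_join r q qs :
  eqr (foldl Join (Join r q) qs) (Join (foldl Join r qs) q).
Proof.
elim: qs r => [|p qs IHqs] r /=; first exact: eqr_refl.
exact: eqr_trans (eqr_foldl _ (eqr_swap _ _ _)) (IHqs _).
Qed.

Lemma deep_twin r t : eqr t (Join (Join r Leaf) Leaf) -> deep t.
Proof.
move=> tr qs; left; exists (foldl Join r qs); apply: eqv_eqr.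
apply: eqr_trans (eqr_foldl _ tr) _; apply: eqr_trans (eqr_foldl_join _ _ _) _.
exact/eqr_joinl/eqr_foldl_join.
Qed.

(** Up to [eqr] the extra trees [qs] can be hung before [q], hence absorbed into [p]. *)
Lemma deep_joinr r q : (forall p, reducible (Join p q)) -> deep (Join r q).
Proof.
by move=> hq qs; apply: reducible_eqv (hq (foldl Join r qs)); apply/eqv_eqr/eqr_foldl_join.
Qed.

Lemma eqr_spider_leaf k : eqr (Join (spider false k) Leaf) (spider true k).
Proof.
elim: k => [|k IHk]; first exact: eqr_refl.
exact: eqr_trans (eqr_swap _ _ _) (eqr_joinl _ IHk).
Qed.

Lemma eqr_spider_true k : eqr (spider true k) (Join (spider false k) Leaf).
Proof.
elim: k => [|k IHk]; first exact: eqr_refl.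
exact: eqr_trans (eqr_joinl _ IHk) (eqr_swap _ _ _).
Qed.

(** If [q] is deep, or a spider with a long leg, then rerooting at [q] shows [Join p q] reducible
    for every [p]. Only very small branches [q] depend on the shape of [r]. *)
Lemma spider_or_deep t : (exists s k, eqr t (spider s k)) \/ deep t.
Proof.
elim: t => [|r IHr q IHq]; first by left; exists false, 0; apply: eqr_refl.
case: IHq => [[s [[|k] qs]]|dq]; last first.
- right; apply: deep_joinr => p; apply: reducible_eqv (eqv_reroot _ _) _.
  exact: dq [:: p].
- right; apply: deep_joinr => p; apply: reducible_eqv (eqv_reroot _ _) _.
  by right; exists s, k.+1, p; split=> //; apply/eqv_eqr/eqr_joinl.
(* Now [q] is [Leaf] or [K2]: it extends a spider [r] to a larger one, unless it is a second leaf at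
   the root, which gives twins. *)
case: IHr => [[s' [k' rs]]|dr]; last first.
  by right=> qs'; apply: (dr (q :: qs')).
have tq := eqr_trans (eqr_joinl q rs) (eqr_joinr _ qs).
case: s => /= in qs tq *; first by left; exists s', k'.+1.
case: s' => /= in rs tq *; last first.
  by left; exists true, k'; apply: eqr_trans tq (eqr_spider_leaf _).
right; apply: (@deep_twin (spider false k')).
exact: eqr_trans tq (eqr_joinl _ (eqr_spider_true _)).
Qed.

(** * The numerical bound *)

(* Four times the bound f(n), an integer for every n. *)
Definition f4 (n : nat) : nat :=
  let y := 2 ^ n./2 in
  if odd n then 4 * y ^ 2 + 2 * (n./2 + 2) * y else 2 * y ^ 2 + (n./2 + 3) * y.

Lemma f4_odd p : f4 p.*2.+1 = 4 * (2 ^ p) ^ 2 + 2 * (p + 2) * 2 ^ p.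
Proof. by rewrite /f4 /= odd_double uphalf_double. Qed.

Lemma f4_even p : f4 p.*2 = 2 * (2 ^ p) ^ 2 + (p + 3) * 2 ^ p.
Proof. by rewrite /f4 odd_double doubleK. Qed.

Lemma n_diss_spider s k : 4 * n_diss (spider s k) = f4 (nverts (spider s k)).
Proof.
have := n_mat_spider s k; rewrite nverts_spider /n_diss n_out_spider n_iso_spider.
move: (n_mat _) => m; case: s => /=.
  by rewrite add1n -doubleS f4_even; rewrite -!mulnn !expnS ?expn1 ?expn0; move: (2 ^ k) => z; nia.
by rewrite add0n f4_odd; rewrite -!mulnn ?expn0; move: (2 ^ k) => z; nia.
Qed.

Lemma ltn_add1_expn2 k : 1 < k -> k.+1 < 2 ^ k.
Proof. by elim: k => [|[|[|k]] IHk] // _; rewrite expnS; have := IHk isT; lia. Qed.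

Lemma ltn_double_expn2 k : 2 < k -> k.*2 < 2 ^ k.
Proof. by elim: k => [|[|[|[|k]]] IHk] // _; rewrite expnS; have := IHk isT; lia. Qed.

(* [D] bounds four times the number of dissociation sets of the tree hanging from
   a spider with [k] long legs; [4 * z] comes from the sets of that tree
   which match its root. *)
Section SplitBound.
Variables (k p D : nat).
Local Notation z := (2 ^ k).
Local Notation y := (2 ^ p).
Hypothesis k_gt0 : 0 < k.

(** Here and in the three lemmas below, inserting the bound on [D] and cancelling a common factor,
    [2 * y * z] or [y * z], leaves the inequality [key]; the summand [4 * z], left out of [key],
    makes the result strict. *)
Lemma split_bound_false_odd : 0 < p -> D <= f4 p.*2.+1 -> (1 < k) || (2 < p) ->
  z ^ 2 * D + z * D + z * k * 2 ^ p.*2.+1 < f4 (p.*2.+1 + k.*2.+1) + 4 * z.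
Proof.
move=> p0 hD h; have -> : p.*2.+1 + k.*2.+1 = (p + k).+1.*2 by lia.
move: hD; rewrite f4_even f4_odd !expnS -muln2 expnM expnD => hD.
(* For [k = 1] this reads [2 * p + 1 <= 2 ^ p], which fails for [p] equal to 1 or 2; hence the last
   hypothesis. *)
have key : (k + 2) * y + z * (p + 2) <= 2 * z * y + k + 2.
  have yp : p < y by apply: ltn_expl.
  have [k1|k1] := leqP k 1.
    have /ltn_double_expn2 : 2 < p by case/orP: h => //; lia.
    by have -> : k = 1 by [lia]; rewrite expn1; lia.
  by have := ltn_add1_expn2 k1; nia.
have := leq_mul (leqnn (z * z + z)) hD.
have := leq_mul (leqnn (2 * y * z)) key.
have : 0 < z by rewrite expn_gt0.
move: z y => a b; lia.
Qed.

Lemma split_bound_false_even : 1 < p -> D <= f4 p.*2 -> (1 < k) || (2 < p) ->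
  z ^ 2 * D + z * D + z * k * 2 ^ p.*2 < f4 (p.*2 + k.*2.+1) + 4 * z.
Proof.
move=> p1 hD h; have -> : p.*2 + k.*2.+1 = (p + k).*2.+1 by lia.
move: hD; rewrite f4_even f4_odd !expnS -muln2 expnM expnD => hD.
have key : (k + 2) * y + z * (p + 3) <= 2 * z * y + 2 * k + p + 1.
  have yp := ltn_add1_expn2 p1.
  have [k1|k1] := leqP k 1.
    have /ltn_double_expn2 : 2 < p by case/orP: h => //; lia.
    by have -> : k = 1 by [lia]; rewrite expn1; lia.
  by have := ltn_add1_expn2 k1; nia.
have := leq_mul (leqnn (z * z + z)) hD.
have := leq_mul (leqnn (y * z)) key.
have : 0 < z by rewrite expn_gt0.
move: z y => a b; lia.
Qed.

Lemma split_bound_true_odd : 0 < p -> D <= f4 p.*2.+1 ->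
  2 * z ^ 2 * D + z * D + z * (2 + k) * 2 ^ p.*2.+1
    < f4 (p.*2.+1 + k.*2.+2) + 4 * z.
Proof.
move=> p0 hD; have -> : p.*2.+1 + k.*2.+2 = (p + k).+1.*2.+1 by lia.
move: hD; rewrite !f4_odd !expnS -muln2 expnM expnD => hD.
have key : (k + 4) * y + z * (2 * p + 4) <= 4 * z * y + 2 * k + p + 4.
  have yp : p < y by apply: ltn_expl.
  by have kz : k < z; [apply: ltn_expl|nia].
have := leq_mul (leqnn (2 * z * z + z)) hD.
have := leq_mul (leqnn (2 * y * z)) key.
have : 0 < z by rewrite expn_gt0.
move: z y => a b; lia.
Qed.

Lemma split_bound_true_even : 1 < p -> D <= f4 p.*2 ->
  2 * z ^ 2 * D + z * D + z * (2 + k) * 2 ^ p.*2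
    < f4 (p.*2 + k.*2.+2) + 4 * z.
Proof.
move=> p1 hD; have -> : p.*2 + k.*2.+2 = (p + k).+1.*2 by lia.
move: hD; rewrite !f4_even !expnS -muln2 expnM expnD => hD.
have key : (k + 4) * y + z * (2 * p + 6) <= 4 * z * y + 2 * k + p + 5.
  have yp := ltn_add1_expn2 p1.
  by have kz : k < z; [apply: ltn_expl|nia].
have := leq_mul (leqnn (2 * z * z + z)) hD.
have := leq_mul (leqnn (y * z)) key.
have : 0 < z by rewrite expn_gt0.
move: z y => a b; lia.
Qed.

End SplitBound.

Lemma n_diss_split s k q :
  4 * n_diss (Join (spider s k) q) =
    2 ^ s * (2 ^ k) ^ 2 * (4 * n_diss q) + 4 * 2 ^ k * (n_out q + n_iso q)
    + 2 ^ k * (s.*2 + k) * (n_out q).*2.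
Proof.
have := n_mat_spider s k.
rewrite {1}/n_diss /= -/(n_diss q) n_out_spider n_iso_spider.
move: (n_mat _) (2 ^ s) (2 ^ k) (n_out q) (n_iso q) => m u z a b h; rewrite -h.
by move: (u * z ^ 2) (n_diss q) => v d; lia.
Qed.

(** Two estimates on [q] are enough: some dissociation set matches its root, and those avoiding its
    root are at most half of all subsets. For the spider [spider false 1] and [q] with at most 5
    vertices they are too weak. *)
Lemma split_lt s k q : 0 < k -> 2 < nverts q -> 4 * n_diss q <= f4 (nverts q) ->
  [|| s, 1 < k | 5 < nverts q] ->
  4 * n_diss (Join (spider s k) q) < f4 (nverts (Join (spider s k) q)).
Proof.
move=> k0 q2 hq hs; rewrite n_diss_split /= nverts_spider [_.+1 + _]addnC.
have [leA _] := counts_le q; have c0 : 0 < n_mat q by apply: n_mat_gt0; lia.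
(* The added term turns [n_out q + n_iso q] into at most [n_diss q], because [n_mat q] is
   positive. *)
rewrite -(ltn_add2r (4 * 2 ^ k)).
have step1 : 4 * 2 ^ k * (n_out q + n_iso q) + 4 * 2 ^ k
    <= 2 ^ k * (4 * n_diss q).
  by rewrite -mulnSr -mulnA mulnCA leq_mul2l leq_mul2l /n_diss; lia.
have step2 : 2 ^ k * (s.*2 + k) * (n_out q).*2
    <= 2 ^ k * (s.*2 + k) * 2 ^ nverts q by rewrite leq_mul2l leA orbT.
suff: 2 ^ s * (2 ^ k) ^ 2 * (4 * n_diss q) + 2 ^ k * (4 * n_diss q)
    + 2 ^ k * (s.*2 + k) * 2 ^ nverts q
    < f4 (nverts q + (s + k.*2).+1) + 4 * 2 ^ k.
  by move=> lt; apply: leq_ltn_trans lt; lia.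
clear step1 step2 leA c0.
have [p op] : exists p, nverts q = p.*2.+1 \/ nverts q = p.*2.
  by exists (nverts q)./2; lia.
case: op q2 hq hs => -> q2 hq hs; case: s hs => /= hs.
- by apply: split_bound_true_odd => //; lia.
- by rewrite mul1n; apply: split_bound_false_odd => //; lia.
- by apply: split_bound_true_even => //; lia.
- by rewrite mul1n; apply: split_bound_false_even => //; lia.
Qed.

Lemma nverts_eq1 t : nverts t = 1 -> t = Leaf.
Proof.
case: t => //= r q; have := nverts_gt0 r; have := nverts_gt0 q; lia.
Qed.

Lemma nverts_eq2 t : nverts t = 2 -> t = K2.
Proof.
case: t => //= r q h; have := nverts_gt0 r; have := nverts_gt0 q => q0 r0.
by rewrite (@nverts_eq1 r) 1?(@nverts_eq1 q) //; lia.
Qed.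

Lemma nverts_eq3 t : nverts t = 3 -> t = Join Leaf K2 \/ t = Join K2 Leaf.
Proof.
case: t => //= r q h; have := nverts_gt0 r; have := nverts_gt0 q => q0 r0.
have [r1|r1] : nverts r = 1 \/ nverts r = 2 by lia.
  by left; rewrite (@nverts_eq1 r) 1?(@nverts_eq2 q) //; lia.
by right; rewrite (@nverts_eq2 r) 1?(@nverts_eq1 q) //; lia.
Qed.

(** The shapes with 4 vertices are listed and each count is evaluated; [split5_lt] does the same for
    5 vertices. *)
Lemma split4_lt t : nverts t = 4 -> 4 * n_diss (Join (Join Leaf K2) t) < f4 7.
Proof.
case: t => //= r q h; have := nverts_gt0 r; have := nverts_gt0 q => q0 r0.
have [r1|[r1|r1]] : nverts r = 1 \/ nverts r = 2 \/ nverts r = 3 by lia.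
- rewrite (@nverts_eq1 r) //.
  by case: (@nverts_eq3 q) => [|->|->] //; lia.
- by rewrite (@nverts_eq2 r) 1?(@nverts_eq2 q) //; lia.
- rewrite (@nverts_eq1 q); last lia.
  by case: (@nverts_eq3 r) => [|->|->].
Qed.

Lemma split5_lt t : nverts t = 5 -> 4 * n_diss (Join (Join Leaf K2) t) < f4 8.
Proof.
have nverts4 u : nverts u = 4 -> exists r q, u = Join r q /\
    [\/ r = Leaf /\ (q = Join Leaf K2 \/ q = Join K2 Leaf), r = K2 /\ q = K2
      | (r = Join Leaf K2 \/ r = Join K2 Leaf) /\ q = Leaf].
  case: u => //= r q h; have := nverts_gt0 r; have := nverts_gt0 q => q0 r0.
  exists r, q; split=> //.
  have [r1|[r1|r1]] : nverts r = 1 \/ nverts r = 2 \/ nverts r = 3 by lia.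
  - by constructor 1; split; [apply: nverts_eq1|apply: nverts_eq3; lia].
  - by constructor 2; split; apply: nverts_eq2 => //; lia.
  - by constructor 3; split; [apply: nverts_eq3|apply: nverts_eq1; lia].
case: t => //= r q h; have := nverts_gt0 r; have := nverts_gt0 q => q0 r0.
have [r1|[r1|[r1|r1]]] :
  nverts r = 1 \/ nverts r = 2 \/ nverts r = 3 \/ nverts r = 4 by lia.
- rewrite (@nverts_eq1 r) //; have [|r' [q' [-> H]]] := nverts4 q; first lia.
  by case: H => [[-> [->|->]]|[-> ->]|[[->|->] ->]].
- rewrite (@nverts_eq2 r) //.
  by case: (@nverts_eq3 q) => [|->|->] //; lia.
- rewrite (@nverts_eq2 q); last lia.
  by case: (@nverts_eq3 r) => [|->|->].
- rewrite (@nverts_eq1 q); last lia.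
  have [//|r' [q' [-> H]]] := nverts4 r.
  by case: H => [[-> [->|->]]|[-> ->]|[[->|->] ->]].
Qed.

(** * Extremal trees and the main induction *)

(** Rooted at an end and with [n.+1] vertices, so P_6 is [path_tree 5]. *)
Definition path_tree n : rtree := iter n (Join Leaf) Leaf.

Definition extremal t :=
  (exists s k, eqv t (spider s k)) \/ eqv t (path_tree 5).

Lemma extremal_eqv t u : eqv t u -> extremal u -> extremal t.
Proof.
move=> tu [[s [k us]]|up]; first by left; exists s, k; apply: eqv_trans us.
by right; apply: eqv_trans up.
Qed.

Definition bounded t :=
  4 * n_diss t <= f4 (nverts t) /\ (4 * n_diss t = f4 (nverts t) -> extremal t).

Lemma bounded_eqv t u : eqv t u -> bounded u -> bounded t.
Proof.
move=> tu; rewrite /bounded (eqv_nverts tu) (eqv_n_diss tu) => -[? h].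
by split=> // /h; apply: extremal_eqv.
Qed.

Lemma bounded_lt t : 4 * n_diss t < f4 (nverts t) -> bounded t.
Proof. by move=> h; split; [apply: ltnW|move=> e; move: h; rewrite e ltnn]. Qed.

Lemma bounded_spider s k : bounded (spider s k).
Proof.
split; first by rewrite n_diss_spider.
by move=> _; left; exists s, k; apply/eqv_eqr/eqr_refl.
Qed.

(** The twin move yields a tree of the same order with more dissociation sets, so its bound is
    strict for the original. The move needs a further vertex next to the root; for [r = Leaf] the
    tree is the path on 3 vertices, a spider after rerooting. *)
Lemma bounded_twin r :
  (forall u, nverts u = (nverts r).+2 ->
     n_diss (Join (Join r Leaf) Leaf) < n_diss u -> bounded u) ->
  bounded (Join (Join r Leaf) Leaf).
Proof.
case: r => [|r q] h.
  apply: (@bounded_eqv _ (spider false 1)); last exact: bounded_spider.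
  exact: eqv_reroot.
have lt := twin_lt r q.
have [|//|leq _] := h (Join (Join r q) K2); first by rewrite /=; lia.
apply: bounded_lt; apply: leq_trans (_ : 4 * n_diss (Join (Join r q) K2) <= _).
  by rewrite ltn_mul2l.
by apply: leq_trans leq _; rewrite /= -!addnA.
Qed.

(* The inner induction is on the number of sets which are not dissociation sets,
   which the twin move decreases. *)
Lemma bounded_rtree t : bounded t.
Proof.
have [n] := ubnP (nverts t); elim: n t => // n IHn t le_tn.
have [m] := ubnP (2 ^ nverts t - n_diss t); elim: m t le_tn => // m IHm t le_tn le_m.
have twin_case r : eqv t (Join (Join r Leaf) Leaf) -> bounded t.
  move=> tr; apply: (bounded_eqv tr); apply: bounded_twin => u ou lt_du.
  have et := eqv_nverts tr; rewrite /= !addn1 in et.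
  apply: IHm; first by lia.
  have := n_diss_le u; rewrite -(eqv_n_diss tr) in lt_du.
  by rewrite ou -et in le_m *; lia.
case: (spider_or_deep t) => [[s [k /eqv_eqr ts]]|/(_ [::]) /= []].
- by apply: (bounded_eqv ts); apply: bounded_spider.
- by case=> r; apply: twin_case.
case=> s [k [q [k0 tq]]].
have oq : nverts q < n.
  by move: le_tn; rewrite (eqv_nverts tq) /= nverts_spider; lia.
have [leq _] := IHn q oq.
(* A branch [q] this small makes the whole tree a spider, or gives twins when both the spider and
   [q] supply a leaf. *)
have [q2|q2] := leqP (nverts q) 2.
  have [q1|{}q2] : nverts q = 1 \/ nverts q = 2 by have := nverts_gt0 q; lia.
    rewrite (nverts_eq1 q1) in tq; case: s tq => tq.
      apply: (@twin_case (spider false k)); apply: eqv_trans tq _.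
      exact/eqv_eqr/eqr_joinl/eqr_spider_true.
    apply: (bounded_eqv tq); apply: bounded_eqv (bounded_spider true k).
    exact/eqv_eqr/eqr_spider_leaf.
  rewrite (nverts_eq2 q2) in tq.
  exact: bounded_eqv tq (bounded_spider s k.+1).
apply: (bounded_eqv tq).
have [h|] := boolP [|| s, 1 < k | 5 < nverts q].
  by apply: bounded_lt; apply: split_lt.
rewrite !negb_or -!leqNgt => /and3P[/negPf sF k1 q5].
have {k0 k1} kE : k = 1 by lia.
subst s k; rewrite /=.
have [/nverts_eq3 [qE|qE]|[q4|{}q5]] : nverts q = 3 \/ nverts q = 4 \/ nverts q = 5.
- by lia.
(* Two paths on 3 vertices joined at their ends form P_6; the two rerootings move the root along a
   leg to its end. *)
- rewrite qE; split=> // _; right.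
  apply: eqv_trans (eqv_eqr (eqr_swap _ _ _)) _.
  apply: eqv_trans (eqv_reroot _ _) _.
  apply: eqv_trans (eqv_eqr (eqr_swap _ _ _)) _.
  exact: eqv_reroot.
- by rewrite qE; apply: bounded_lt.
- by apply: bounded_lt; rewrite /= q4; apply: split4_lt.
- by apply: bounded_lt; rewrite /= q5; apply: split5_lt.
Qed.

(** * Graphs of a given shape *)

(** The inequality makes the two lists disjoint; the equation fixes non-edges too, so [realises]
    describes an induced subgraph. *)
Definition linked (V : eqType) (e : rel V) x s y s' : Prop :=
  forall v w, v \in x :: s -> w \in y :: s' ->
    v != w /\ e v w = (v == x) && (w == y).

(* [x :: s] consists of the vertices of a subgraph of [e] of shape [t], with [x] at
   the root, listed as the [Leaf]s of [t] from left to right. *)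
Fixpoint realises (V : eqType) (e : rel V) (t : rtree) (x : V) (s : seq V) : Prop :=
  match t with
  | Leaf => s = [::]
  | Join r q => exists s1 y s2, [/\ s = s1 ++ y :: s2,
      realises e r x s1, realises e q y s2 & linked e x s1 y s2]
  end.

Section Realisation.
Variables (V : eqType) (e : rel V).
Hypothesis e_sym : symmetric e.

Lemma linked_sub x s1 s1' y s2 s2' :
  {subset x :: s1' <= x :: s1} -> {subset y :: s2' <= y :: s2} ->
  linked e x s1 y s2 -> linked e x s1' y s2'.
Proof. by move=> h1 h2 h v w /h1 v1 /h2 w2; apply: h. Qed.

Lemma linked_sym x s1 y s2 : linked e x s1 y s2 -> linked e y s2 x s1.
Proof.
by move=> h v w v2 w1; have [] := h w v w1 v2; rewrite eq_sym e_sym andbC.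
Qed.

Lemma linked_catl x s1 y s2 z s3 :
  linked e x s1 z s3 -> {in y :: s2 & z :: s3, forall v w, v != w /\ e v w = false} ->
  x \notin y :: s2 -> linked e x (s1 ++ y :: s2) z s3.
Proof.
move=> h1 h2 xN v w; rewrite -cat_cons mem_cat => /orP[v1|v2] w3; first exact: h1.
have [vw ->] := h2 v w v2 w3; split=> //.
by case: eqP => // vx; rewrite -vx v2 in xN.
Qed.

Lemma realises_size t x s : realises e t x s -> size (x :: s) = nverts t.
Proof.
elim: t x s => [|r IHr q IHq] x s /=; first by move=> ->.
by case=> s1 [y [s2 [-> /IHr <- /IHq <- _]]]; rewrite size_cat /=.
Qed.

Lemma realises_uniq t x s : realises e t x s -> uniq (x :: s).
Proof.
elim: t x s => [|r IHr q IHq] x s; first by move=> /= ->.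
case=> s1 [y [s2 [-> /IHr u1 /IHq u2 h]]].
rewrite -cat_cons cat_uniq u1 u2 andbT; apply/hasPn => w w2; apply/negP => w1.
by have [] := h w w w1 w2; rewrite eqxx.
Qed.

Lemma realises_eqr t u x s : eqr t u -> realises e t x s ->
  exists2 s', perm_eq s s' & realises e u x s'.
Proof.
move=> tu; elim: tu x s => {t u}.
- by move=> t x s; exists s.
- move=> t u v _ IH1 _ IH2 x s /IH1[s1 p1 /IH2[s2 p2 h]].
  by exists s2 => //; apply: perm_trans p2.
- move=> r p q x s [_ [z [s3 [-> [s1 [y [s2 [-> hr hp h12]]]] hq h3]]]].
  exists ((s1 ++ z :: s3) ++ y :: s2).
    by rewrite -!catA perm_cat2l perm_catC.
  have h13 : linked e x s1 z s3.
    by apply: linked_sub h3 => // v; rewrite -cat_cons mem_cat => ->.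
  exists (s1 ++ z :: s3), y, s2; split=> //; first by exists s1, z, s3.
  apply: linked_catl => //.
    move=> v w v3 w2.
    have w12 : w \in x :: s1 ++ y :: s2 by rewrite -cat_cons mem_cat w2 orbT.
    have [wv ewv] := h3 w v w12 v3; rewrite eq_sym e_sym ewv; split=> //.
    have [xw _] := h12 x w (mem_head _ _) w2.
    by rewrite eq_sym (negPf xw).
  apply/negP => x3; have [] := h13 x x (mem_head _ _) x3; by rewrite eqxx.
- move=> r r' q _ IH x s [s1 [y [s2 [-> hr hq h]]]].
  have [s1' p1 hr'] := IH _ _ hr.
  exists (s1' ++ y :: s2); first by rewrite perm_cat2r.
  exists s1', y, s2; split=> //; apply: linked_sub h => // v.
  by rewrite !inE (perm_mem p1).
- move=> r q q' _ IH x s [s1 [y [s2 [-> hr hq h]]]].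
  have [s2' p2 hq'] := IH _ _ hq.
  exists (s1 ++ y :: s2'); first by rewrite perm_cat2l perm_cons.
  exists s1, y, s2'; split=> //; apply: linked_sub h => // v.
  by rewrite !inE (perm_mem p2).
Qed.

Lemma realises_eqv t u x s : eqv t u -> realises e t x s ->
  exists x' s', perm_eq (x :: s) (x' :: s') /\ realises e u x' s'.
Proof.
move=> tu; elim: tu x s => {t u}.
- move=> t u tu x s /(realises_eqr tu)[s' p h].
  by exists x, s'; rewrite perm_cons.
- move=> r q x s [s1 [y [s2 [-> hr hq h]]]]; exists y, (s2 ++ x :: s1); split.
    by rewrite -!cat_cons perm_catC.
  by exists s2, x, s1; split=> //; apply: linked_sym.
- move=> t u v _ IH1 _ IH2 x s /IH1[x1 [s1 [p1 /IH2[x2 [s2 [p2 h]]]]]].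
  by exists x2, s2; split=> //; apply: perm_trans p2.
Qed.

(** The [Leaf] standing for [v] is replaced by [K2]. This lists [w] inside [s'] rather than at its
    front, hence the permutation. *)
Lemma realises_add t x s v w : realises e t x s ->
  v \in x :: s -> w \notin x :: s -> {in x :: s, forall u, e u w = (u == v)} ->
  exists t' s', realises e t' x s' /\ perm_eq (w :: s) s'.
Proof.
elim: t x s => [|r IHr q IHq] x s.
  move=> -> /[!inE] /eqP -> wx h; exists K2, [:: w]; split=> //.
  exists [::], w, [::]; split=> // a b /[!inE] /eqP -> /eqP ->.
  by rewrite eqxx eq_sym wx h ?inE ?eqxx.
case=> s1 [y [s2 [-> hr hq h12]]].
rewrite -cat_cons !mem_cat negb_or => vs /andP[w1 w2] hw.
have hw1 : {in x :: s1, forall u, e u w = (u == v)}.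
  by move=> u u1; apply: hw; rewrite mem_cat u1.
have hw2 : {in y :: s2, forall u, e u w = (u == v)}.
  by move=> u u2; apply: hw; rewrite mem_cat u2 orbT.
case/orP: vs => [v1|v2].
  have [r' [s1' [hr' p]]] := IHr _ _ hr v1 w1 hw1.
  exists (Join r' q), (s1' ++ y :: s2); split; last by rewrite -cat_cons perm_cat2r.
  exists s1', y, s2; split=> // a b.
  rewrite inE -(perm_mem p) inE orbCA -in_cons => /orP[/eqP -> b2|]; last exact: h12.
  rewrite e_sym hw2 //; have [vb _] := h12 v b v1 b2.
  have /negPf -> : w != x by case: eqP w1 => // ->; rewrite mem_head.
  rewrite [b == v]eq_sym (negPf vb); split=> //.
  by case: eqP w2 => // ->; rewrite b2.
have [q' [s2' [hq' p]]] := IHq _ _ hq v2 w2 hw2.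
exists (Join r q'), (s1 ++ y :: s2'); split.
  exists s1, y, s2'; split=> // a b a1.
  rewrite inE -(perm_mem p) inE orbCA -in_cons => /orP[/eqP ->|]; last exact: h12.
  rewrite hw1 //; have [av _] := h12 a v a1 v2.
  have /negPf -> : w != y by case: eqP w2 => // ->; rewrite mem_head.
  rewrite (negPf av) andbF; split=> //.
  by case: eqP w1 => // <-; rewrite a1.
rewrite -cat1s perm_catCA perm_cat2l /= .
by rewrite -[w :: y :: s2]/([:: w] ++ [:: y] ++ s2) perm_catCA perm_cons.
Qed.

End Realisation.

(** Adjacency depends only on the shape and on positions in the list, so matching positions of two
    realisations of [t] gives an isomorphism. *)
Lemma realises_edge (V V' : eqType) (e : rel V) (e' : rel V') t x s x' s' i j :
  symmetric e -> irreflexive e -> symmetric e' -> irreflexive e' ->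
  realises e t x s -> realises e' t x' s' -> i < nverts t -> j < nverts t ->
  e (nth x (x :: s) i) (nth x (x :: s) j) =
  e' (nth x' (x' :: s') i) (nth x' (x' :: s') j).
Proof.
move=> e_sym e_irr e_sym' e_irr'.
elim: t x s x' s' i j => [|r IHr q IHq] x s x' s' i j.
  by move=> -> ->; case: i; case: j => //; rewrite /= e_irr e_irr'.
case=> s1 [y [s2 [-> hr hq h]]] [s1' [y' [s2' [-> hr' hq' h']]]] /=.
have cross k l : k < nverts r -> l < nverts q ->
    e (nth x (x :: s1) k) (nth y (y :: s2) l) =
    e' (nth x' (x' :: s1') k) (nth y' (y' :: s2') l).
  move=> kr lq.
  have := realises_size hr; have := realises_size hr'.
  have := realises_size hq; have := realises_size hq' => z2' z2 z1' z1.
  have m1 : nth x (x :: s1) k \in x :: s1 by rewrite mem_nth ?z1.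
  have m2 : nth y (y :: s2) l \in y :: s2 by rewrite mem_nth ?z2.
  have m1' : nth x' (x' :: s1') k \in x' :: s1' by rewrite mem_nth ?z1'.
  have m2' : nth y' (y' :: s2') l \in y' :: s2' by rewrite mem_nth ?z2'.
  have [_ ->] := h _ _ m1 m2; have [_ ->] := h' _ _ m1' m2'.
  have head_eq (U : eqType) (a : U) l' m : uniq (a :: l') -> m < size (a :: l') ->
      (nth a (a :: l') m == a) = (m == 0).
    by move=> ul ml; rewrite -[X in _ == X]/(nth a (a :: l') 0) nth_uniq.
  rewrite !head_eq ?z1 ?z2 ?z1' ?z2' //.
  - exact: realises_uniq hq'.
  - exact: realises_uniq hr'.
  - exact: realises_uniq hq.
  - exact: realises_uniq hr.
have split_nth (U : eqType) (a : U) l b l' k : size (a :: l) = nverts r ->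
    k < nverts r + nverts q -> size (b :: l') = nverts q ->
    nth a (a :: l ++ b :: l') k =
    if k < nverts r then nth a (a :: l) k else nth b (b :: l') (k - nverts r).
  move=> zl kn zl'; rewrite -cat_cons nth_cat zl; case: ltnP => // rk.
  by apply: set_nth_default; rewrite zl'; lia.
move=> iN jN.
have zr := realises_size hr; have zr' := realises_size hr'.
have zq := realises_size hq; have zq' := realises_size hq'.
rewrite -!cat_cons !(split_nth V) // !(split_nth V') //.
case: ltnP => ir; case: ltnP => jr.
- exact: IHr.
- by apply: cross => //; lia.
- by rewrite e_sym e_sym'; apply: cross => //; lia.
- by apply: IHq => //; lia.
Qed.

Lemma realises_map (V V' : eqType) (e : rel V) (e' : rel V') (h : V -> V') t x s :
  {in x :: s &, injective h} -> {in x :: s &, forall v w, e' (h v) (h w) = e v w} ->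
  realises e t x s -> realises e' t (h x) (map h s).
Proof.
elim: t x s => [|r IHr q IHq] x s; first by move=> _ _ /= ->.
move=> hinj he [s1 [y [s2 [sE hr hq h12]]]]; subst s.
have s1P : {subset x :: s1 <= x :: s1 ++ y :: s2}.
  by move=> v v1; rewrite -cat_cons mem_cat v1.
have s2P : {subset y :: s2 <= x :: s1 ++ y :: s2}.
  by move=> v v2; rewrite -cat_cons mem_cat v2 orbT.
exists (map h s1), (h y), (map h s2); split; first by rewrite map_cat.
- by apply: IHr hr => [v w /s1P ? /s1P ?|v w /s1P ? /s1P ?]; [apply: hinj|apply: he].
- by apply: IHq hq => [v w /s2P ? /s2P ?|v w /s2P ? /s2P ?]; [apply: hinj|apply: he].
move=> a b; rewrite -!map_cons => /mapP[v v1 ->] /mapP[w w2 ->].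
have [vw evw] := h12 v w v1 w2.
have v12 := s1P v v1; have w12 := s2P w w2.
have x12 := s1P x (mem_head _ _); have y12 := s2P y (mem_head _ _).
by rewrite he // evw !(inj_in_eq hinj).
Qed.

(** The relation [symc] before restriction to ordinals: over [nat] the vertex lists are [iota] and
    the inductions on [k] keep one vertex type. *)
Definition symn (b : nat -> nat -> bool) : rel nat := fun i j => b i j || b j i.

Lemma symn_sym b : symmetric (symn b).
Proof. by move=> i j; rewrite /symn orbC. Qed.

(** The leg added last is the outermost [Join] and takes the two largest labels, so the order of the
    leaves is that of the labels. *)
Lemma realises_b_odd k :
  realises (symn b_odd) (spider false k) 0 (iota 1 k.*2).
Proof.
elim: k => [|k IHk] //; rewrite doubleS -addn2 iotaD.
exists (iota 1 k.*2), k.*2.+1, [:: k.*2.+2]; split=> //.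
  exists [::], k.*2.+2, [::]; split=> // v w; rewrite !inE => /eqP -> /eqP ->.
  by rewrite /symn /b_odd; lia.
move=> v w; rewrite -[0 :: iota 1 k.*2]/(iota 0 k.*2.+1) mem_iota !inE.
by rewrite /symn /b_odd; lia.
Qed.

Lemma realises_b_even k :
  realises (symn b_even) (spider true k) 0 (iota 1 k.*2.+1).
Proof.
elim: k => [|k IHk].
  exists [::], 1, [::]; split=> // v w; rewrite !inE => /eqP -> /eqP ->.
  by rewrite /symn /b_even; lia.
rewrite doubleS -addn2 iotaD.
exists (iota 1 k.*2.+1), k.*2.+2, [:: k.*2.+3]; split=> //.
  exists [::], k.*2.+3, [::]; split=> // v w; rewrite !inE => /eqP -> /eqP ->.
  by rewrite /symn /b_even; lia.
move=> v w; rewrite -[0 :: iota 1 k.*2.+1]/(iota 0 k.*2.+2) mem_iota !inE.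
by rewrite /symn /b_even; lia.
Qed.

Lemma realises_b_path m n :
  realises (symn b_path) (path_tree n) m (iota m.+1 n).
Proof.
elim: n m => //= n IHn m; exists [::], m.+1, (iota m.+2 n); split=> // v w.
rewrite mem_seq1 => /eqP ->; rewrite -[m.+1 :: _]/(iota m.+1 n.+1) mem_iota.
by rewrite /symn /b_path; lia.
Qed.

(** * Counting dissociation sets *)

Section Counting.
Variables (V : finType) (e : rel V).
Hypotheses (e_sym : symmetric e) (e_irr : irreflexive e).
Implicit Types (S D : {set V}) (x y : V).

Definition deg D x := #|[set y in D | e x y]|.

Definition diss_out x D := dissociation e D && (x \notin D).
Definition diss_iso x D := [&& dissociation e D, x \in D & deg D x == 0].
Definition diss_mat x D := [&& dissociation e D, x \in D & deg D x == 1].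

(** As a sum of booleans, a count inherits the product formulas [diss_outU], [diss_isoU] and
    [diss_matU] termwise. *)
Definition count_in S (P : {set V} -> bool) : nat := \sum_(D : {set V} | D \subset S) P D.

Lemma diss_split x D :
  (dissociation e D : nat) = diss_out x D + diss_iso x D + diss_mat x D.
Proof.
rewrite /diss_out /diss_iso /diss_mat.
have [dD|] //= := boolP (dissociation e D); have [xD|] //= := boolP (x \in D).
by have := forall_inP dD x xD; rewrite -/(deg D x); case: (deg D x) => [|[|]].
Qed.

Lemma count_in_split x S :
  count_in S (dissociation e) =
    count_in S (diss_out x) + count_in S (diss_iso x) + count_in S (diss_mat x).
Proof. by rewrite -!big_split; apply: eq_bigr => D _; apply: diss_split. Qed.

(** A subset [D] of the union corresponds to the pair of its traces on [S1] and [S2]. *)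
Lemma big_subsetU (S1 S2 : {set V}) (F : {set V} -> nat) : [disjoint S1 & S2] ->
  \sum_(D : {set V} | D \subset S1 :|: S2) F D =
  \sum_(D1 : {set V} | D1 \subset S1) \sum_(D2 : {set V} | D2 \subset S2) F (D1 :|: D2).
Proof.
move=> dS; rewrite pair_big_dep /=.
rewrite (reindex_onto (fun p : {set V} * {set V} => p.1 :|: p.2)
  (fun D => (D :&: S1, D :&: S2))) /=; last first.
  by move=> D DS; rewrite -setIUr; apply/setIidPl.
apply: eq_bigl => -[D1 D2] /=; apply/idP/idP.
  by case/andP=> _ /eqP[<- <-]; rewrite !subsetIr.
case/andP=> s1 s2; rewrite setUSS //=.
have d12 : D1 :&: S2 = set0 by apply/disjoint_setI0/(disjointWl s1).
have d21 : D2 :&: S1 = set0.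
  by apply/disjoint_setI0; rewrite disjoint_sym; apply: (disjointWr s2).
rewrite !setIUl d12 d21 setU0 set0U; apply/eqP.
by congr pair; apply/setIidPl.
Qed.

(** The situation of [Join]: [S1] and [S2] are the vertex sets of the two subtrees, [x] and [y]
    their roots. *)
Section Link.
Variables (x y : V) (S1 S2 : {set V}).
Hypotheses (xS : x \in S1) (yS : y \in S2).
Hypothesis link : forall v w, v \in S1 -> w \in S2 ->
  v != w /\ e v w = (v == x) && (w == y).

Lemma link_disjoint : [disjoint S1 & S2].
Proof.
apply/pred0P => v /=; apply/negP => /andP[v1 v2].
by have [] := link v1 v2; rewrite eqxx.
Qed.

Variables (D1 D2 : {set V}).
Hypotheses (sD1 : D1 \subset S1) (sD2 : D2 \subset S2).

Lemma degU v : deg (D1 :|: D2) v = deg D1 v + deg D2 v.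
Proof.
rewrite /deg -cardsUI (_ : _ :&: _ = set0) ?cards0 ?addn0; last first.
  apply/setP => w; rewrite !inE; apply/negP => /andP[/andP[w1 _] /andP[w2 _]].
  by have [] := link (subsetP sD1 w w1) (subsetP sD2 w w2); rewrite eqxx.
by apply: eq_card => w; rewrite !inE andb_orl.
Qed.

Lemma deg_linkl v : v \in S1 -> deg D2 v = (v == x) && (y \in D2).
Proof.
move=> v1; rewrite /deg; have [/andP[/eqP vx y2]|h] := boolP (_ && _).
  rewrite (_ : [set _ in _ | _] = [set y]) ?cards1 //.
  apply/setP => w; rewrite !inE; have [w2|w2] := boolP (w \in D2).
    by have [_ ->] := link v1 (subsetP sD2 w w2); rewrite vx eqxx.
  by case: eqP => // wy; rewrite wy y2 in w2.
apply/eqP; rewrite cards_eq0; apply/eqP/setP => w; rewrite !inE.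
apply/negP => /andP[w2]; have [_ ->] := link v1 (subsetP sD2 w w2).
by case/andP=> /eqP vx /eqP wy; rewrite vx eqxx -wy w2 in h.
Qed.

Lemma deg_linkr v : v \in S2 -> deg D1 v = (v == y) && (x \in D1).
Proof.
move=> v2; rewrite /deg; have [/andP[/eqP vy x1]|h] := boolP (_ && _).
  rewrite (_ : [set _ in _ | _] = [set x]) ?cards1 //.
  apply/setP => w; rewrite !inE e_sym; have [w1|w1] := boolP (w \in D1).
    by have [_ ->] := link (subsetP sD1 w w1) v2; rewrite vy eqxx andbT.
  by case: eqP => // wx; rewrite wx x1 in w1.
apply/eqP; rewrite cards_eq0; apply/eqP/setP => w; rewrite !inE e_sym.
apply/negP => /andP[w1]; have [_ ->] := link (subsetP sD1 w w1) v2.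
by case/andP=> /eqP wx /eqP vy; rewrite vy eqxx -wx w1 in h.
Qed.

(** Only [x] and [y] can gain a neighbour across the link. If both are chosen they are matched to
    each other, so each must be isolated on its own side. *)
Lemma dissU : dissociation e (D1 :|: D2) =
  [&& dissociation e D1, dissociation e D2
    & (x \in D1) && (y \in D2) ==> (deg D1 x == 0) && (deg D2 y == 0)].
Proof.
have in1 v : v \in D1 -> deg (D1 :|: D2) v = deg D1 v + ((v == x) && (y \in D2)).
  by move=> v1; rewrite degU deg_linkl // (subsetP sD1).
have in2 v : v \in D2 -> deg (D1 :|: D2) v = deg D2 v + ((v == y) && (x \in D1)).
  by move=> v2; rewrite degU addnC deg_linkr // (subsetP sD2).
apply/forall_inP/and3P => [dU|[/forall_inP d1 /forall_inP d2 /implyP h] v].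
  have le1 v : v \in D1 -> deg D1 v + ((v == x) && (y \in D2)) <= 1.
    by move=> v1; rewrite -in1 //; apply: dU; rewrite inE v1.
  have le2 v : v \in D2 -> deg D2 v + ((v == y) && (x \in D1)) <= 1.
    by move=> v2; rewrite -in2 //; apply: dU; rewrite inE v2 orbT.
  split.
  - by apply/forall_inP => v /le1; apply: leq_trans; apply: leq_addr.
  - by apply/forall_inP => v /le2; apply: leq_trans; apply: leq_addr.
  apply/implyP => /andP[x1 y2]; have := le1 x x1; have := le2 y y2.
  by rewrite x1 y2 !eqxx !addn1 !ltnS !leqn0 => -> ->.
rewrite inE -/(deg _ v) => /orP[v1|v2].
  rewrite in1 //; have := d1 v v1; rewrite -/(deg _ v).
  case: eqP => [vx|_]; rewrite ?addn0 //=; case: (boolP (y \in D2)) => [y2|_].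
    by rewrite -vx v1 y2 in h; have /andP[/eqP -> _] := h isT.
  by rewrite addn0.
rewrite in2 //; have := d2 v v2; rewrite -/(deg _ v).
case: eqP => [vy|_]; rewrite ?addn0 //=; case: (boolP (x \in D1)) => [x1|_].
  by rewrite -vy v2 x1 in h; have /andP[_ /eqP ->] := h isT.
by rewrite addn0.
Qed.

Lemma in_linkl : (x \in D1 :|: D2) = (x \in D1).
Proof.
rewrite inE; case: (boolP (x \in D2)) => [x2|]; last by rewrite orbF.
by have [] := link xS (subsetP sD2 x x2); rewrite eqxx.
Qed.

Lemma diss_outU :
  (diss_out x (D1 :|: D2) : nat) = diss_out x D1 * dissociation e D2.
Proof.
rewrite /diss_out dissU in_linkl; case: (x \in D1); rewrite /= ?andbF ?andbT ?mulnb //.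
Qed.

Lemma deg_linkU : deg (D1 :|: D2) x = deg D1 x + (y \in D2).
Proof. by rewrite degU deg_linkl // eqxx. Qed.

Lemma diss_isoU :
  (diss_iso x (D1 :|: D2) : nat) = diss_iso x D1 * diss_out y D2.
Proof.
rewrite /diss_iso /diss_out dissU in_linkl deg_linkU mulnb.
case: (dissociation e D1) => //=; case: (dissociation e D2); rewrite ?andbF //=.
by case: (x \in D1) => //=; case: (y \in D2); case: (deg D1 x); case: (deg D2 y).
Qed.

(** The partner of [x] lies in [D1], which forces [y] out, or is [y] itself. *)
Lemma diss_matU :
  (diss_mat x (D1 :|: D2) : nat) =
    diss_mat x D1 * diss_out y D2 + diss_iso x D1 * diss_iso y D2.
Proof.
rewrite /diss_iso /diss_out /diss_mat dissU in_linkl deg_linkU !mulnb.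
case: (dissociation e D1) => //=; case: (dissociation e D2); rewrite ?andbF //=.
case: (x \in D1) => //=; case: (y \in D2); case: (deg D1 x) => [|[|n]];
  by case: (deg D2 y).
Qed.

End Link.

Lemma count_in_prod S1 S2 (P Q : {set V} -> bool) :
  \sum_(D1 : {set V} | D1 \subset S1) \sum_(D2 : {set V} | D2 \subset S2) P D1 * Q D2
    = count_in S1 P * count_in S2 Q.
Proof. by rewrite big_distrlr. Qed.

Lemma realises_counts t x s : realises e t x s ->
  let S := [set v in x :: s] in
  [/\ count_in S (diss_out x) = n_out t, count_in S (diss_iso x) = n_iso t
    & count_in S (diss_mat x) = n_mat t].
Proof.
elim: t x s => [|r IHr q IHq] x s /=.
  move=> ->; rewrite (_ : [set v in [:: x]] = set0 :|: [set x]); last first.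
    by apply/setP => v; rewrite !inE.
  have dx : [disjoint set0 & [set x]] by rewrite -setI_eq0 set0I.
  have big1s (F : {set V} -> nat) :
      \sum_(D : {set V} | D \subset [set x]) F D = F set0 + F [set x].
    rewrite (bigD1 set0) ?sub0set //= (bigD1 [set x]) /=; last first.
      by rewrite subxx -card_gt0 cards1.
    rewrite big1 ?addn0 // => D /andP[/andP[]]; rewrite subset1.
    by case/orP=> ->.
  have diss0 : dissociation e set0 by apply/forall_inP => v; rewrite inE.
  have degx D : D \subset [set x] -> deg D x = 0.
    move=> sD; apply/eqP; rewrite cards_eq0; apply/eqP/setP => w; rewrite !inE.
    by apply/negP => /andP[/(subsetP sD) /set1P ->]; rewrite e_irr.
  have diss1 : dissociation e [set x].
    by apply/forall_inP => v /set1P ->; rewrite -/(deg _ x) degx.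
  rewrite set0U /count_in !big1s /diss_out /diss_iso /diss_mat.
  by rewrite !degx ?sub0set // diss0 diss1 !inE eqxx.
case=> s1 [y [s2 [-> hr hq h]]].
have [r1 r2 r3] := IHr _ _ hr; have [q1 q2 q3] := IHq _ _ hq.
move: r1 r2 r3 q1 q2 q3.
rewrite (_ : [set v in x :: s1 ++ y :: s2] =
  [set v in x :: s1] :|: [set v in y :: s2]); last first.
  by apply/setP => v; rewrite !inE mem_cat !inE -!orbA.
set S1 := [set v in x :: s1]; set S2 := [set v in y :: s2].
move=> r1 r2 r3 q1 q2 q3.
have xS : x \in S1 by rewrite !inE eqxx.
have yS : y \in S2 by rewrite !inE eqxx.
have lk v w : v \in S1 -> w \in S2 -> v != w /\ e v w = (v == x) && (w == y).
  by rewrite [v \in _]inE [w \in _]inE; apply: h.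
have dS := link_disjoint lk.
have dq : count_in S2 (dissociation e) = n_out q + n_iso q + n_mat q.
  by rewrite (count_in_split y) q1 q2 q3.
rewrite -dq -r1 -r2 -r3 -q1 -q2 /count_in; split; rewrite big_subsetU //.
- rewrite -count_in_prod; apply: eq_bigr => D1 sD1; apply: eq_bigr => D2 sD2.
  exact: diss_outU lk _ _ _ _.
- rewrite -count_in_prod; apply: eq_bigr => D1 sD1; apply: eq_bigr => D2 sD2.
  exact: diss_isoU lk _ _ _ _.
- rewrite -!count_in_prod -big_split; apply: eq_bigr => D1 sD1.
  rewrite -big_split; apply: eq_bigr => D2 sD2.
  exact: diss_matU lk _ _ _ _.
Qed.

Lemma realises_dnum t x s : realises e t x s -> (forall v, v \in x :: s) ->
  dnum e = n_diss t.
Proof.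
move=> /realises_counts; set S := [set v in _] => -[h1 h2 h3] hs.
rewrite /n_diss -h1 -h2 -h3 -count_in_split /count_in /dnum.
rewrite -sum1_card big_mkcond [RHS]big_mkcond; apply: eq_bigr => D _.
have -> : D \subset S by apply/subsetP => v _; rewrite inE hs.
by rewrite inE; case: (dissociation e D).
Qed.

End Counting.

(** * Trees as graphs *)

Section Spanning.
Variables (V : finType) (e : rel V).
Hypotheses (e_sym : symmetric e) (e_irr : irreflexive e).

(** Confines paths to [L], so that a vertex outside [L] closes them to a cycle without
    repetition. *)
Definition restr (L : seq V) : rel V := fun a b => [&& e a b, a \in L & b \in L].

Lemma restr_connect_sym L : connect_sym (restr L).
Proof.
by apply: sym_connect_sym => a b; rewrite /restr e_sym [(a \in L) && _]andbC.
Qed.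

Lemma restr_sub L L' : {subset L <= L'} ->
  subrel (connect (restr L)) (connect (restr L')).
Proof.
move=> sL; apply: connect_sub => a b /and3P[eab /sL aL /sL bL].
by apply: connect1; rewrite /restr eab aL bL.
Qed.

Lemma realises_connect t x s v : realises e t x s -> v \in x :: s ->
  connect (restr (x :: s)) x v.
Proof.
elim: t x s v => [|r IHr q IHq] x s v /=.
  by move=> -> /[!inE] /eqP ->; apply: connect0.
case=> s1 [y [s2 [-> hr hq h]]].
have s1P : {subset x :: s1 <= x :: s1 ++ y :: s2}.
  by move=> u u1; rewrite -cat_cons mem_cat u1.
have s2P : {subset y :: s2 <= x :: s1 ++ y :: s2}.
  by move=> u u2; rewrite -cat_cons mem_cat u2 orbT.
rewrite -cat_cons mem_cat => /orP[v1|v2].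
  exact: restr_sub s1P _ _ (IHr _ _ _ hr v1).
apply: connect_trans (restr_sub s2P (IHq _ _ _ hq v2)).
have [_ exy] := h x y (mem_head _ _) (mem_head _ _).
by apply: connect1; rewrite /restr exy !eqxx mem_head (s2P y) ?mem_head.
Qed.

(* Two neighbours of [w] in the tree would close a cycle through [w]. *)
Lemma acyclic_attach t x s u v w : acyclic_graph e -> realises e t x s ->
  w \notin x :: s -> u \in x :: s -> v \in x :: s -> e u w -> e v w -> u = v.
Proof.
move=> eA hr wN uL vL euw evw; apply/eqP/negPn/negP => uv.
have /connectP[p0 p0e p0l] : connect (restr (x :: s)) u v.
  apply: connect_trans (realises_connect hr vL).
  by rewrite restr_connect_sym; apply: realises_connect hr uL.
case/shortenP: p0e p0l => p pe pu _ vE.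
have pL : {subset p <= x :: s}.
  elim: (p) (u) pe => // b l IHl a /= /andP[/and3P[_ _ bL] /IHl lP] c.
  by rewrite inE => /orP[/eqP ->|/lP].
suff /eA : ucycle e (w :: u :: p).
  by case: p vE {pe pu pL} => //= vE; rewrite vE eqxx in uv.
apply/andP; split; last first.
  rewrite cons_uniq pu andbT inE negb_or; apply/andP; split.
    by case: eqP wN => // ->; rewrite uL.
  by apply/negP => /pL; apply/negP.
rewrite /= e_sym euw rcons_path -vE evw andbT.
by apply: sub_path pe => a b /and3P[].
Qed.

(** A realised subtree grows by one vertex at a time: connectedness supplies an edge leaving it,
    acyclicity makes that edge the only one to the new vertex. Growth stops by finiteness. *)
Lemma realises_spanning : is_tree e -> 0 < #|V| ->
  exists t x s, realises e t x s /\ forall v, v \in x :: s.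
Proof.
case=> eC eA /card_gt0P[x0 _].
have grow m : exists t x s, realises e t x s /\
    ((forall v, v \in x :: s) \/ m < size (x :: s)).
  elim: m => [|m [t [x [s [hr [hs|ms]]]]]].
  - by exists Leaf, x0, [::]; split=> //; right.
  - by exists t, x, s; split=> //; left.
  have [/forallP hs|/forallPn[w wN]] := boolP [forall v, v \in x :: s].
    by exists t, x, s; split=> //; left.
  (* The first edge leaving the list on a path from [x] to the missing vertex [w]. *)
  have [a [b [aL bN eab]]] : exists a b, [/\ a \in x :: s, b \notin x :: s & e a b].
    have /connectP[p pe wE] := eC x w; rewrite {}wE in wN.
    have := mem_head x s; move: (x :: s) wN pe => L.
    elim: p x {hr ms} => [|b p IHp] a /=; first by move=> /negPf ->.
    move=> lN /andP[eab pe] aL; have [bL|bN] := boolP (b \in L).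
      exact: IHp lN pe bL.
    by exists a, b.
  have [|t' [s' [hr' ps]]] := realises_add e_sym hr aL bN.
    move=> u uL; apply/idP/eqP => [eub|->//].
    exact: acyclic_attach eA hr bN uL aL eub eab.
  by exists t', x, s'; split=> //; right; rewrite /= -(perm_size ps).
have [t [x [s [hr [hs|lt]]]]] := grow #|V|; first by exists t, x, s.
by move: lt; rewrite -(card_uniqP (realises_uniq hr)) ltnNge max_card.
Qed.

Lemma spanning_nverts t x s : realises e t x s -> (forall v, v \in x :: s) ->
  nverts t = #|V|.
Proof.
move=> hr hs; rewrite -(realises_size hr) -(card_uniqP (realises_uniq hr)).
by apply: eq_card => v; rewrite hs.
Qed.

Lemma realises_iso b t x s :
  irreflexive (symn b) -> realises e t x s -> (forall v, v \in x :: s) ->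
  realises (symn b) t 0 (iota 1 #|V|.-1) -> iso_to e (symc b #|V|).
Proof.
move=> b_irr hr hs hb; have ot := spanning_nverts hr hs.
have V0 : #|V| = #|V|.-1.+1 by rewrite prednK // -ot nverts_gt0.
have idx_lt v : index v (x :: s) < #|V|.
  by rewrite -ot -(realises_size hr) index_mem.
exists (fun v => Ordinal (idx_lt v)); split.
  apply: inj_card_bij; last by rewrite card_ord.
  move=> v w /(congr1 val) vw; rewrite -(nth_index x (hs v)).
  by move: vw => /= ->; rewrite -[if _ then _ else _]/(index w (x :: s)) nth_index.
move=> v w; rewrite -[LHS](_ : e (nth x (x :: s) (index v (x :: s)))
    (nth x (x :: s) (index w (x :: s))) = _); last by rewrite !nth_index.
rewrite (realises_edge e_sym e_irr (symn_sym b) b_irr hr hb) ?ot //.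
rewrite -[0 :: _]/(iota 0 #|V|.-1.+1) -V0.
by rewrite !nth_iota ?add0n.
Qed.

(** The inverse isomorphism carries the realisation of [t] on labels into [V], where [realises_dnum]
    counts. *)
Lemma iso_n_diss b t :
  0 < #|V| -> nverts t = #|V| ->
  realises (symn b) t 0 (iota 1 (nverts t).-1) -> iso_to e (symc b #|V|) ->
  dnum e = n_diss t.
Proof.
move=> V0 ot hb [g [[g' gK g'K] ge]].
have /card_gt0P[x0 _] := V0.
(* The inverse [g'] extended to all of [nat]; only labels below [#|V|] are used. *)
pose h i := if insub i is Some o then g' o else x0.
have hE v : h (g v) = v by rewrite /h valK gK.
have iotaE : 0 :: iota 1 (nverts t).-1 = iota 0 #|V|.
  by rewrite -[LHS]/(iota 0 (nverts t).-1.+1) prednK ?nverts_gt0 ?ot.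
have inV i : i \in 0 :: iota 1 (nverts t).-1 -> exists v, i = g v.
  rewrite iotaE mem_iota /= add0n => iV; exists (g' (Ordinal iV)).
  by rewrite g'K.
have hr : realises e t (h 0) (map h (iota 1 (nverts t).-1)).
  apply: realises_map hb.
    by move=> i j /inV[v ->] /inV[w ->]; rewrite !hE => ->.
  by move=> i j /inV[v ->] /inV[w ->]; rewrite !hE ge.
apply: (realises_dnum e_sym e_irr hr) => v; rewrite -map_cons -[v]hE map_f //.
by rewrite iotaE mem_iota add0n ltn_ord.
Qed.

End Spanning.

Lemma symn_b_odd_irr : irreflexive (symn b_odd).
Proof. by move=> i; rewrite /symn /b_odd; lia. Qed.

Lemma symn_b_even_irr : irreflexive (symn b_even).
Proof. by move=> i; rewrite /symn /b_even; lia. Qed.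

Lemma symn_b_path_irr : irreflexive (symn b_path).
Proof. by move=> i; rewrite /symn /b_path; lia. Qed.

(** * The rational bound and the theorem *)

Import Order.TTheory GRing.Theory Num.Theory.
Local Open Scope ring_scope.

Lemma fboundE n : (0 < n)%N -> 4 * fbound n = (f4 n)%:R.
Proof.
move=> n0.
(* The integer exponents in [fbound] can be negative, so the power is written as a quotient. *)
have expB (p m : nat) : (2 : rat) ^ (p%:Z - m%:Z) = 2 ^+ p / 2 ^+ m.
  by rewrite expfzDr // -exprnN.
have [p [nE|nE]] : exists p, n = p.*2.+1 \/ n = p.+1.*2.
  by exists n.-1./2; lia.
  rewrite nE f4_odd /fbound /= odd_double uphalf_double /= (expB p 2%N).
  by rewrite -addnn -addn1 !(natrD, natrM, natrX) exprD; field.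
rewrite nE f4_even /fbound odd_double doubleK (expB p.+1 3%N).
rewrite -addnn addSn addnS /= !(natrD, natrM, natrX) !exprS exprD.
by rewrite -?natr1 ?natrD; field.
Qed.

Theorem theorem3p1 (T : finType) (e : rel T)
  (e_sym : symmetric e) (e_irr : irreflexive e) (e_tree : is_tree e)
  (n_ge1 : (1 <= #|T|)%N) :
  ((dnum e)%:R <= fbound #|T| :> rat) /\
  ((dnum e)%:R = fbound #|T| :> rat <->
     (if odd #|T| then iso_to e (symc b_odd #|T|)
      else if #|T| == 6%N then
        iso_to e (symc b_path #|T|) \/ iso_to e (symc b_even #|T|)
      else iso_to e (symc b_even #|T|))).
Proof.
have [t [x [s [hr hs]]]] := realises_spanning e_sym e_tree n_ge1.
have ot := spanning_nverts hr hs.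
have dE := realises_dnum e_sym e_irr hr hs.
have [le_f eq_f] := bounded_rtree t.
have pos4 : (0 < 4 :> rat)%R by [].
split.
  by rewrite -(ler_pM2l pos4) fboundE // -natrM ler_nat dE -ot.
(* Equality is moved to the integers, for the shape [t] of a spanning realisation. *)
have -> : ((dnum e)%:R = fbound #|T| :> rat) <-> (4 * n_diss t)%N = f4 (nverts t).
  rewrite ot -dE; split=> [h|h].
    by apply/eqP; rewrite -(eqr_nat rat) natrM h fboundE.
  by apply: (mulfI (lt0r_neq0 pos4)); rewrite fboundE // -natrM h.
have b_odd_r : odd #|T| ->
    realises (symn b_odd) (spider false #|T|./2) 0%N (iota 1 #|T|.-1).
  by move=> oT; have -> : #|T|.-1 = (#|T|./2).*2 by [lia]; apply: realises_b_odd.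
have b_even_r : ~~ odd #|T| ->
    realises (symn b_even) (spider true #|T|.-1./2) 0%N (iota 1 #|T|.-1).
  move=> oT; have -> : iota 1 #|T|.-1 = iota 1 (#|T|.-1./2).*2.+1.
    by congr iota; lia.
  exact: realises_b_even.
have b_path_r : #|T| = 6%N -> realises (symn b_path) (path_tree 5) 0%N (iota 1 #|T|.-1).
  by move=> ->; apply: realises_b_path.
split=> [/eq_f ext|iso].
  have iso_of b u : irreflexive (symn b) -> eqv t u ->
      realises (symn b) u 0%N (iota 1 #|T|.-1) -> iso_to e (symc b #|T|).
    move=> b_irr tu hb; have [x' [s' [p hr']]] := realises_eqv e_sym tu hr.
    apply: (realises_iso e_sym e_irr b_irr hr') hb => v.
    by rewrite -(perm_mem p).
  (* The order of the graph determines both parameters of the spider: its parity gives [b], then its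
     size gives [k]. *)
  case: ext => [[b [k tu]]|tu]; have := eqv_nverts tu; rewrite ot.
    rewrite nverts_spider; case: b tu => tu oT.
      have oF : odd #|T| = false by lia.
      have h : iso_to e (symc b_even #|T|).
        apply: (iso_of _ _ symn_b_even_irr tu).
        have -> : k = #|T|.-1./2 by lia.
        by apply: b_even_r; rewrite oF.
      by rewrite oF; case: ifP => // _; right.
    have oF : odd #|T| by lia.
    rewrite oF; apply: (iso_of _ _ symn_b_odd_irr tu).
    have -> : k = #|T|./2 by lia.
    exact: b_odd_r.
  move=> oT; have -> : odd #|T| = false by rewrite oT.
  have -> : (#|T| == 6)%N by rewrite oT.
  left.
  by apply: (iso_of _ _ symn_b_path_irr tu); apply: b_path_r.
(* Conversely, a graph isomorphic to a model has the count of the model, which attains the bound. *)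
have eq_of b u : nverts u = #|T| -> (4 * n_diss u)%N = f4 (nverts u) ->
    realises (symn b) u 0%N (iota 1 #|T|.-1) -> iso_to e (symc b #|T|) ->
    (4 * n_diss t)%N = f4 (nverts t).
  move=> ou fu hb h; rewrite -ou in hb.
  by rewrite -dE (iso_n_diss e_sym e_irr n_ge1 ou hb h) ot -ou.
have eq_even : ~~ odd #|T| -> iso_to e (symc b_even #|T|) ->
    (4 * n_diss t)%N = f4 (nverts t).
  move=> oT; apply: eq_of (b_even_r oT); last exact: n_diss_spider.
  by rewrite nverts_spider; lia.
case: ifP iso => oT.
  apply: eq_of (b_odd_r oT); last exact: n_diss_spider.
  by rewrite nverts_spider; lia.
case: eqP => [n6 [iso|iso]|_ iso].
(* For P_6 the equality with the bound is a numerical evaluation. *)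
- by apply: eq_of (b_path_r n6) iso; rewrite ?n6.
- by apply: eq_even; rewrite ?oT.
- by apply: eq_even; rewrite ?oT.
Qed.
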